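(* Let $N,q,p$ be positive integers with $\gcd(N,q)=\gcd(N,p)=1$. If $p$ and $q$ have different parities (and thus $N$ is odd), then $K(N,q,p)$ is preserved by the involution of $\mathbb{R}^3$ $$(x,y,z)\mapsto(-x,-y,-z).$$ Hence $K(N,q,p)$ is positive strongly amphicheiral.
   Context: For positive integers $N,q,p$ with $\gcd(N,q)=\gcd(N,p)=1$ and $\phi\in\mathbb{R}$, $K(N,q,p,\phi)$ is the closed curve in $\mathbb{R}^3$ given for $t\in[0,2\pi]$ by $x=(2+\sin(qt))\cos(Nt)$, $y=(2+\sin(qt))\sin(Nt)$, $z=\cos(p(t+\phi))$. The phase $\phi$ is critical if the knot is singular for this phase. For non-critical $\phi$ the knot type does not depend on $\phi$ up to mirror image, so $\phi$ is dropped from the notation and one writes $K(N,q,p)$. A knot is positive strongly amphicheiral if it has a representative preserved, together with its orientation, by an orientation-reversing involution of $\mathbb{S}^3=\mathbb{R}^3\cup\{\infty\}$.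
   Formalization: For q odd and p even the curve itself is not preserved by (x,y,z)->(-x,-y,-z) (e.g. N=q=1, p=2); there ''K(N,q,p) is preserved'' is read as: for every non-critical phase its oriented knot type has a preserved representative. *)

(* Defs.v *)
(* MathComp-Analysis, over an arbitrary [R : realType]. *)
From HB Require Import structures.
From mathcomp Require Import all_boot all_order all_algebra.
From mathcomp Require Import all_classical all_reals all_analysis.

Set Implicit Arguments.
Unset Strict Implicit.
Unset Printing Implicit Defensive.
Import Order.TTheory GRing.Theory Num.Theory.
Import numFieldNormedType.Exports.
Local Open Scope classical_set_scope.
Local Open Scope ring_scope.

Section Knots.
Variables (R : realType) (X : topologicalType).

(* Closed curves are 2pi-periodic maps, oriented by increasing parameter. *)
Definition is_knot (K : R -> X) : Prop :=
  [/\ continuous K,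
      forall t, K (t + pi *+ 2) = K t &
      {in `[0, pi *+ 2[ &, injective K}].

(* Lifts to R of the orientation-preserving homeomorphisms of R / 2 pi Z. *)
Definition orientation_preserving_reparam (tau : R -> R) : Prop :=
  [/\ continuous tau,
      {homo tau : s t / s < t} &
      forall t, tau (t + pi *+ 2) = tau t + pi *+ 2].

Definition continuous_family (H : R -> X -> X) : Prop :=
  {within [set u : R * X | u.1 \in `[0, 1]],
     continuous (fun u : R * X => H u.1 u.2)}.

Definition ambient_isotopy (H : R -> X -> X) : Prop :=
  H 0 =1 id /\
  exists G : R -> X -> X,
    [/\ continuous_family H, continuous_family G &
        forall s, s \in `[0, 1] -> cancel (H s) (G s) /\ cancel (G s) (H s)].

Definition isotopic (K K' : R -> X) : Prop :=
  exists2 H, ambient_isotopy H &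
  exists2 tau, orientation_preserving_reparam tau &
    forall t, H 1 (K t) = K' (tau t).

(* [h] maps the curve onto itself, respecting its orientation. *)
Definition preserved_with_orientation (h : X -> X) (K : R -> X) : Prop :=
  exists2 tau, orientation_preserving_reparam tau &
    forall t, h (K t) = K (tau t).

Definition has_preserved_representative (h : X -> X) (K : R -> X) : Prop :=
  exists K', [/\ is_knot K', isotopic K K' & preserved_with_orientation h K'].

End Knots.

Section ThreeSphere.
Variable R : realType.
Local Notation R3 := 'rV[R]_3.

Definition point3 (x y z : R) : R3 := \row_(i < 3) [:: x; y; z]`_i.

Definition S3 := one_point_compactification R3.

(* The inversion x |-> x / |x|^2 followed by the reflection z |-> -z: an
   orientation-preserving involution of R^3 \ {0}.  The norm is written out
   because the library's norm on row vectors is the sup norm. *)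
Definition inversion (x : R3) : R3 :=
  (\sum_i x ord0 i ^+ 2)^-1 *: point3 (x ord0 0) (x ord0 1) (- x ord0 2%:R).

(* Oriented atlas of S^3: the chart [false] covers R^3, the chart [true] covers
   the complement of the origin and sends 0 to infinity. *)
Definition chart_dom (c : bool) : set S3 :=
  if c then [set y | y <> Some 0] else [set y | y <> None].

Definition chart (c : bool) (x : R3) : S3 :=
  if c && (x == 0) then None else Some (if c then inversion x else x).

Definition chart_inv (c : bool) (y : S3) : R3 :=
  if y is Some x then (if c then inversion x else x) else 0.

Fixpoint Ck_at (k : nat) (f : R3 -> R3) (x : R3) : Prop :=
  if k is k'.+1 then
    (\forall y \near x, differentiable f y) /\
    (forall v : R3, Ck_at k' (fun y => 'D_v f y) x)
  else \forall y \near x, {for y, continuous f}.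

Definition smooth_at (f : R3 -> R3) (x : R3) : Prop := forall k, Ck_at k f x.

(* Since coordinate changes are smooth with positive Jacobian determinant, it
   is immaterial which charts are used around [y] and [h y]. *)
Definition orientation_reversing_involution (h : S3 -> S3) : Prop :=
  [/\ involutive h,
      continuous h &
      forall y, exists c d : bool,
        let g := chart_inv d \o h \o chart c in
        [/\ chart_dom c y, chart_dom d (h y),
            smooth_at g (chart_inv c y) &
            \det ('J g (chart_inv c y)) < 0]].

Definition positive_strongly_amphicheiral (K : R -> R3) : Prop :=
  exists2 h : S3 -> S3, orientation_reversing_involution h &
    has_preserved_representative h (fun t => Some (K t) : S3).

End ThreeSphere.

Section LissajousToric.
Variable R : realType.

Definition lissajous_toric (N q p : nat) (phi t : R) : 'rV[R]_3 :=
  point3 ((2 + sin (q%:R * t)) * cos (N%:R * t))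
         ((2 + sin (q%:R * t)) * sin (N%:R * t))
         (cos (p%:R * (t + phi))).

(* The curve winds around the z-axis at constant speed N > 0 and at distance at
   least 1, so it is always immersed: its only singularities are multiple
   points. *)
Definition critical_phase (N q p : nat) (phi : R) : Prop :=
  exists s t : R, [/\ 0 <= s, s < t, t < pi *+ 2 &
    lissajous_toric N q p phi s = lissajous_toric N q p phi t].

Definition antipode (x : 'rV[R]_3) : 'rV[R]_3 :=
  point3 (- x ord0 0) (- x ord0 1) (- x ord0 2%:R).

End LissajousToric.

(* Main.v *)
Require Import Defs.
From mathcomp Require Import all_boot all_order all_algebra.
From mathcomp Require Import all_classical all_reals all_analysis.
From mathcomp Require Import ring lra.
Import Order.TTheory GRing.Theory Num.Theory.
Import numFieldNormedType.Exports.
Set Implicit Arguments.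
Unset Strict Implicit.
Unset Printing Implicit Defensive.
Local Open Scope classical_set_scope.
Local Open Scope ring_scope.

(** Let K be the curve.  Since gcd(N, q) = gcd(N, p) = 1 and one of p, q is even,
    N is odd, so the half-period shift t |-> t + pi turns the longitude N t by an
    odd multiple of pi: the point moves to the opposite half-plane bounded by
    the z-axis ([lissajous_toricDpi]).  In that half-plane, with coordinates
    r = 2 + sin (q t) and z = cos (p (t + phi)), the shift multiplies r - 2 by
    (-1)^q and z by (-1)^p.

    If q is even and p is odd, r is unchanged and z changes sign, which is
    exactly what the antipode does: K (t + pi) = - K t.

    If q is odd and p is even, the shift changes the sign of r - 2 and fixes z
    instead.  The two coordinates are exchanged by a quarter turn of the (r, z)
    half-plane about the point (2, 0).  Performed in all half-planes at once, the
    turn rotates a solid torus about its core circle (r, z) = (2, 0).  The curve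
    lies in (r - 2)^2 + z^2 <= 2 and the z-axis at (r - 2)^2 + z^2 >= 4, so
    the rotation angle can be damped to 0 between these two regions; this gives
    the ambient isotopy [twist], stationary off a ball ([twist_isotopy]).  It
    carries K to a curve that the antipode maps to itself with the shift by pi
    ([antipode_twist_lissajous_toric]).

    A non-critical phase makes K a knot ([lissajous_toric_knot]).  An isotopy that
    is stationary off a ball extends to the 3-sphere by fixing infinity
    ([compactly_supported_ambient_S3]).  So does the antipode; it commutes with
    the inversion, hence reads x |-> - x in both charts, of Jacobian determinant
    -1 ([antipode_orientation_reversing]).  The symmetry in R^3 therefore proves
    positive strong amphicheirality as well ([symmetric_after_isotopy]). *)

(** * Isotopies and symmetric representatives *)

Lemma reparam_shift (R : realType) (c : R) :
  orientation_preserving_reparam (fun t : R => t + c).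
Proof.
split.
- by move=> t; apply: cvgD; [exact: cvg_id | exact: cvg_cst].
- by move=> s t st; rewrite ltrD2r.
- by move=> t; rewrite addrAC.
Qed.

Lemma ambient_isotopy_continuous (R : realType) (X : topologicalType)
    (H : R -> X -> X) : continuous_family H -> continuous (H 1).
Proof.
move=> /subspace_continuousP cH x U UHx.
have A1 : [set u : R * X | u.1 \in `[0, 1]] (1, x).
  by rewrite /= in_itv /= ler01 lexx.
have := cH (1, x) A1 U UHx.
rewrite /= /within /= => -[[P Q] /= [P1 Qx] PQ].
change (nbhs x (fun y => U (H 1 y))).
apply: filterS Qx => y Qy.
apply: (PQ (1, y)); first by split => //; exact: nbhs_singleton P1.
by rewrite /= in_itv /= ler01 lexx.
Qed.

(** A symmetry that acts on the deformed curve as the half-period shift of the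
    parameter respects its orientation, a translation being increasing. *)
Lemma has_preserved_representative_isotopy (R : realType) (X : topologicalType)
    (h : X -> X) (K : R -> X) (H : R -> X -> X) :
  is_knot K -> ambient_isotopy H ->
  (forall t, h (H 1 (K t)) = H 1 (K (t + pi))) ->
  has_preserved_representative h K.
Proof.
move=> [cK perK injK] isoH hK.
have [_ [G [cH _ HG]]] := isoH.
have [|HK _] := HG 1; first by rewrite in_itv /= ler01 lexx.
exists (H 1 \o K); split.
- split.
  + move=> t; apply: continuous_comp; first exact: cK.
    exact: ambient_isotopy_continuous.
  + by move=> t /=; rewrite perK.
  + by move=> s t s0 t0 /= /(can_inj HK); exact: injK.
- exists H => //; exists (fun t => t + 0); first exact: reparam_shift.
  by move=> t; rewrite addr0.
- by exists (fun t => t + pi); first exact: reparam_shift.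
Qed.

(** * Extension to the 3-sphere *)

Section OnePointExtension.
Variable R : realType.
Local Notation R3 := 'rV[R]_3.

(** Continuity at infinity is uniform properness: neighbourhoods of infinity are
    complements of compact sets, and these are the bounded closed ones. *)
Lemma omap_family_continuous (T : topologicalType) (F : T -> R3 -> R3) :
  continuous (fun u : T * R3 => F u.1 u.2) ->
  (forall M, exists M', forall t x, M' < `|x| -> M < `|F t x|) ->
  continuous (fun u : T * S3 R => omap (F u.1) u.2 : S3 R).
Proof.
move=> cF pF [t [x|]] U /=.
  move=> UF; have [[P Q] /= [Pt Qx] PQ] := cF (t, x) _ UF.
  exists (P, Some @` Q) => /=.
    by split => //; exact: one_point_compactification_some_nbhs.
  move=> [s y] /= [Ps [z Qz <-]] /=; exact: (PQ (s, z)).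
move=> [C [cC _] CU].
have [M [_ /(_ (M + 1)) CM]] := compact_bounded cC.
have {}CM x : C x -> `|x| <= M + 1 by apply: CM; rewrite ltrDl.
have [M' M'P] := pF (M + 1).
exists (setT, (Some @` (~` [set x | `|x| <= M'])) `|` [set None]) => /=.
  split; first exact: filterT.
  exists [set x : R3 | `|x| <= M'] => //.
  have clo : closed [set x : R3 | `|x| <= M'].
    apply: (@preimage_closed _ _ (fun x : R3 => `|x|) [set y | y <= M']).
      by move=> x _; exact: norm_continuous.
    exact: closed_le.
  split => //; apply: bounded_closed_compact => //.
  exists M'; split; first exact: num_real.
  by move=> N MN x /= xM; apply: le_trans xM (ltW MN).
move=> [s y] /= [_ [[z /= zM <-]|->]] /=; apply: CU; last by right.
left; exists (F s z) => //= /CM; apply/negP; rewrite -ltNge; apply: M'P.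
by rewrite ltNge; apply/negP.
Qed.

(** The time parameter runs over the whole line, where continuity can be stated
    without restricting to a subspace. *)
Definition compactly_supported_isotopy (H : R -> R3 -> R3) : Prop :=
  [/\ H 0 =1 id,
      exists M, forall s x, M < `|x| -> H s x = x &
      exists G : R -> R3 -> R3,
        [/\ continuous (fun u : R * R3 => H u.1 u.2),
            continuous (fun u : R * R3 => G u.1 u.2) &
            forall s, cancel (H s) (G s) /\ cancel (G s) (H s)]].

Lemma compactly_supported_ambient (H : R -> R3 -> R3) :
  compactly_supported_isotopy H -> ambient_isotopy H.
Proof.
move=> [H0 _ [G [cH cG HG]]]; split=> //; exists G; split=> //.
- exact: continuous_subspaceT.
- exact: continuous_subspaceT.
Qed.

Lemma compactly_supported_ambient_S3 (H : R -> R3 -> R3) :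
  compactly_supported_isotopy H ->
  ambient_isotopy (fun s (y : S3 R) => omap (H s) y : S3 R).
Proof.
have proper (F : R -> R3 -> R3) M : (forall s x, M < `|x| -> F s x = x) ->
    forall N, exists N', forall s x, N' < `|x| -> N < `|F s x|.
  move=> FM N; exists (Num.max M N) => s x; rewrite gt_max => /andP[Mx Nx].
  by rewrite FM.
move=> [H0 [M HM] [G [cH cG HG]]]; split=> [[x|//]|] /=; first by rewrite H0.
have GM s x : M < `|x| -> G s x = x.
  by move=> Mx; rewrite -[x in G s x](HM s) // (HG s).1.
exists (fun s (y : S3 R) => omap (G s) y : S3 R); split.
- apply: continuous_subspaceT; apply: omap_family_continuous => //.
  exact: proper HM.
- apply: continuous_subspaceT; apply: omap_family_continuous => //.
  exact: proper GM.
- by move=> s _; split=> -[x|//] /=; rewrite ?(HG s).1 ?(HG s).2.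
Qed.

End OnePointExtension.

(** * The antipode of the 3-sphere *)

Section Antipode.
Variable R : realType.
Local Notation R3 := 'rV[R]_3.

Lemma ord3_ind (P : 'I_3 -> Prop) : P 0 -> P 1 -> P 2%:R -> forall i, P i.
Proof.
move=> P0 P1 P2 [[|[|[|//]]] i3].
- by rewrite (_ : Ordinal i3 = 0) //; exact: val_inj.
- by rewrite (_ : Ordinal i3 = 1) //; exact: val_inj.
- by rewrite (_ : Ordinal i3 = 2%:R) //; exact: val_inj.
Qed.

Lemma point3E (x y z : R) : (point3 x y z ord0 0 = x) *
  (point3 x y z ord0 1 = y) * (point3 x y z ord0 2%:R = z).
Proof. by rewrite !mxE. Qed.

Lemma point3_eta (v : R3) : point3 (v ord0 0) (v ord0 1) (v ord0 2%:R) = v.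
Proof.
by apply/rowP; apply: ord3_ind; rewrite point3E.
Qed.

Lemma antipodeE : @antipode R = -%R.
Proof.
by apply/funext => v; apply/rowP; apply: ord3_ind; rewrite /antipode point3E mxE.
Qed.

Lemma inversionN (x : R3) : inversion (- x) = - inversion x.
Proof.
rewrite /inversion -scalerN; congr (_^-1 *: _).
  by apply: eq_bigr => i _; rewrite mxE sqrrN.
by apply/rowP; apply: ord3_ind; rewrite [RHS]mxE !point3E !mxE ?opprK.
Qed.

Lemma inversion0 : inversion (0 : R3) = 0.
Proof.
by rewrite /inversion big1 ?invr0 ?scale0r // => i _; rewrite mxE expr0n.
Qed.

Lemma inversionK (x : R3) : inversion (inversion x) = x.
Proof.
have [->|x0] := eqVneq x 0; first by rewrite !inversion0.
rewrite {1}/inversion.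
have sumE (v : R3) : \sum_i v ord0 i ^+ 2 =
    v ord0 0 ^+ 2 + v ord0 1 ^+ 2 + v ord0 2%:R ^+ 2.
  rewrite !big_ord_recr big_ord0 /= add0r.
  by do !congr (_ + _); congr (v _ _ ^+ _); apply: val_inj.
have n0 : \sum_i x ord0 i ^+ 2 != 0.
  apply: contra x0; rewrite psumr_eq0 => [/allP z|i _]; last exact: sqr_ge0.
  apply/eqP/rowP => i; rewrite mxE.
  by have := z i (mem_index_enum _); rewrite /= sqrf_eq0 => /eqP.
rewrite !sumE in n0 *; set n := _ + _ + _ in n0.
have E : inversion x ord0 0 ^+ 2 + inversion x ord0 1 ^+ 2
    + inversion x ord0 2%:R ^+ 2 = n^-1.
  by rewrite !mxE /= sumE -/n; rewrite /n; field.
rewrite E invrK; apply/rowP; apply: ord3_ind;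
  by rewrite [LHS]mxE !point3E !mxE /= sumE -/n ?mulrN ?opprK mulVKf.
Qed.

Lemma smooth_cst (c : R3) (x : R3) : smooth_at (fun=> c) x.
Proof.
move=> k; elim: k c x => [|k IH] c x /=.
  by apply: (@filterE _ (nbhs x)) => y; exact: cst_continuous.
split; first by apply: (@filterE _ (nbhs x)) => y; exact: differentiable_cst.
move=> v; have -> : (fun y => 'D_v (fun=> c) y) = cst (0 : R3); last exact: IH.
by apply/funext => y; rewrite derive_cst.
Qed.

Lemma is_diff_oppr (x : R3) : is_diff x (-%R : R3 -> R3) -%R.
Proof. exact: (is_diffN (is_diff_id x)). Qed.

Lemma smooth_oppr (x : R3) : smooth_at (-%R : R3 -> R3) x.
Proof.
have df y : differentiable (-%R : R3 -> R3) y.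
  by have [] := is_diff_oppr y.
case=> [|k] /=.
  by apply: (@filterE _ (nbhs x)) => y; exact: differentiable_continuous.
split; first exact: (@filterE _ (nbhs x)).
move=> v; have -> : (fun y => 'D_v (-%R : R3 -> R3) y) = cst (- v);
  last exact: smooth_cst.
apply/funext => y; rewrite deriveE //.
by have [_ ->] := is_diff_oppr y.
Qed.

Lemma det_jacobian_oppr (x : R3) : \det ('J (-%R : R3 -> R3) x) = -1.
Proof.
have [_ dE] := is_diff_oppr x.
rewrite (_ : 'J _ x = (-1)%:M); first by rewrite det_scalar -signr_odd expr1.
apply/row_matrixP => i; rewrite !rowE mul_rV_lin1 dE mul_mx_scalar.
by rewrite scaleN1r.
Qed.

(** Around both the finite points and infinity, source and target use the same
    chart; as the inversion commutes with x |-> - x, the map reads x |-> - x in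
    either one. *)
Lemma antipode_orientation_reversing :
  orientation_reversing_involution (fun y : S3 R => omap (@antipode R) y).
Proof.
rewrite antipodeE; split.
- by move=> [x|//] /=; rewrite opprK.
- have c : continuous (fun u : R * S3 R => omap -%R u.2 : S3 R).
    apply: (@omap_family_continuous R R (fun=> -%R)).
      move=> u; apply: (@continuous_comp _ _ _ (@snd R R3) (-%R : R3 -> R3)).
        exact: cvg_snd.
      exact: opp_continuous.
    by move=> M; exists M => t x; rewrite normrN.
  move=> y; apply: (@continuous_comp _ _ _ (pair (0 : R)) _ y _ (c (0, y))).
  move=> U [[P Q] /= [P0 Qy] PQ]; apply: filterS Qy => z Qz.
  by apply: PQ; split => //; exact: nbhs_singleton P0.
- move=> [x|].
    exists false, false => /=.
    have -> : chart_inv false \o omap -%R \o chart false = -%R :> (R3 -> R3).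
      by apply/funext.
    by split => //; [exact: smooth_oppr | rewrite det_jacobian_oppr ltrN10].
  exists true, true => /=.
  have -> : chart_inv true \o omap -%R \o chart true = -%R :> (R3 -> R3).
    apply/funext => x; rewrite /= /chart /=.
    have [->|x0 /=] := eqVneq x 0; first by rewrite oppr0.
    by rewrite inversionN inversionK.
  by split => //; [exact: smooth_oppr | rewrite det_jacobian_oppr ltrN10].
Qed.

Lemma symmetric_after_isotopy (K : R -> R3) (H : R -> R3 -> R3) :
  is_knot K -> compactly_supported_isotopy H ->
  (forall t, antipode (H 1 (K t)) = H 1 (K (t + pi))) ->
  has_preserved_representative (@antipode R) K /\
  positive_strongly_amphicheiral K.
Proof.
move=> kK iH sym; split.
  apply: has_preserved_representative_isotopy sym => //.
  exact: compactly_supported_ambient.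
exists (fun y => omap (@antipode R) y).
  exact: antipode_orientation_reversing.
apply: (has_preserved_representative_isotopy
          (H := fun s (y : S3 R) => omap (H s) y : S3 R)).
- have [cK perK injK] := kK; split.
  + move=> t; apply: continuous_comp; first exact: cK.
    exact: one_point_compactification_some_continuous.
  + by move=> t; rewrite perK.
  + by move=> s t s0 t0 [/injK]; apply.
- exact: compactly_supported_ambient_S3.
- by move=> t /=; rewrite sym.
Qed.

End Antipode.

(** * Continuity of explicit formulas *)

Section RealContinuity.
Variables (R : realType) (T : topologicalType).
Implicit Types f g h : T -> R.

Lemma fun_continuousD f g :
  continuous f -> continuous g -> continuous (fun t => f t + g t).
Proof. by move=> cf cg t; apply: cvgD; [exact: cf | exact: cg]. Qed.

Lemma fun_continuousN f : continuous f -> continuous (fun t => - f t).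
Proof. by move=> cf t; apply: cvgN; exact: cf. Qed.

Lemma fun_continuousM f g :
  continuous f -> continuous g -> continuous (fun t => f t * g t).
Proof. by move=> cf cg t; apply: cvgM; [exact: cf | exact: cg]. Qed.

Lemma fun_continuousV f :
  (forall t, f t != 0) -> continuous f -> continuous (fun t => (f t)^-1).
Proof. by move=> f0 cf t; apply: cvgV; [exact: f0 | exact: cf]. Qed.

Lemma fun_continuous_comp (k : R -> R) f :
  continuous k -> continuous f -> continuous (fun t => k (f t)).
Proof.
by move=> ck cf t; apply: continuous_comp; [exact: cf | exact: ck].
Qed.

Lemma point3_continuous f g h : continuous f -> continuous g -> continuous h ->
  continuous (fun t => point3 (f t) (g t) (h t)).
Proof.
move=> cf cg ch t A [P nP PA].
have n0 : \forall u \near t, P ord0 0 (f u).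
  by apply: (cf t); have := nP ord0 0; rewrite point3E.
have n1 : \forall u \near t, P ord0 1 (g u).
  by apply: (cg t); have := nP ord0 1; rewrite point3E.
have n2 : \forall u \near t, P ord0 2%:R (h u).
  by apply: (ch t); have := nP ord0 2%:R; rewrite point3E.
apply: filterS (filterI (filterI n0 n1) n2) => u [[u0 u1] u2]; apply: PA => i.
by rewrite (ord1 i); apply: ord3_ind; rewrite point3E.
Qed.

End RealContinuity.

(** The goals are matched syntactically: plain unification would unfold real
    arithmetic in search of a sum or a product. *)
Ltac prove_continuous := repeat match goal with
  | |- continuous (fun _ => ?c) => exact: cst_continuous
  | |- continuous (fun u => @?f u + @?g u) => apply: (@fun_continuousD _ _ f g)
  | |- continuous (fun u => - @?f u) => apply: (@fun_continuousN _ _ f)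
  | |- continuous (fun u => @?f u * @?g u) => apply: (@fun_continuousM _ _ f g)
  | |- continuous (fun u => sin (@?f u)) =>
      apply: (@fun_continuous_comp _ _ _ f (@continuous_sin _))
  | |- continuous (fun u => cos (@?f u)) =>
      apply: (@fun_continuous_comp _ _ _ f (@continuous_cos _))
  | |- continuous (fun u => Num.sqrt (@?f u)) =>
      apply: (@fun_continuous_comp _ _ _ f (@sqrt_continuous _))
  | |- continuous (fun u => `|@?f u|) =>
      apply: (@fun_continuous_comp _ _ _ f (@norm_continuous _ _))
  | |- continuous (fun u => point3 (@?f u) (@?g u) (@?h u)) =>
      apply: (@point3_continuous _ _ f g h)
  | H : continuous ?f |- continuous ?f => exact: H
  | H : forall i, continuous _ |- _ => exact: H
  end.

(** * The twist of a solid torus *)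

Section QuarterTurn.
Variable R : realType.
Local Notation R3 := 'rV[R]_3.

Definition axis_dist (x : R3) : R :=
  Num.sqrt (x ord0 0 * x ord0 0 + x ord0 1 * x ord0 1).

(** The square of the distance to the core circle r = 2, z = 0. *)
Definition core_dist2 (x : R3) : R :=
  (axis_dist x - 2) * (axis_dist x - 2) + x ord0 2%:R * x ord0 2%:R.

(** The rotation by [a] of every half-plane bounded by the z-axis, about its point
    at distance 2 from the axis; [k] is the ratio of the new distance to the axis
    to the old one.  The denominator [4^-1 + `|r - 4^-1|] equals [r] when
    [4^-1 <= r], and never vanishes, so that the formula is continuous everywhere,
    the z-axis included.  It is a rotation only for [4^-1 <= r]; nearer to the
    axis, [twist] uses it with [a = 0], as the identity. *)
Definition turn (a : R) (x : R3) : R3 :=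
  let r := axis_dist x in
  let z := x ord0 2%:R in
  let k := 1 + ((cos a - 1) * (r - 2) - sin a * z) / (4^-1 + `|r - 4^-1|) in
  point3 (x ord0 0 * k) (x ord0 1 * k) (sin a * (r - 2) + cos a * z).

(** The piecewise affine function equal to 1 up to 2 and to 0 from 3 on. *)
Definition cutoff (u : R) : R := (`|3 - u| - `|2 - u| + 1) / 2.

Definition twist (s : R) (x : R3) : R3 :=
  turn (s * (pi / 2) * cutoff (core_dist2 x)) x.

Lemma cutoff_in u : u <= 2 -> cutoff u = 1.
Proof. by move=> u2; rewrite /cutoff !ger0_norm; lra. Qed.

Lemma cutoff_out u : 3 <= u -> cutoff u = 0.
Proof. by move=> u3; rewrite /cutoff !ler0_norm; lra. Qed.

Lemma turn0 x : turn 0 x = x.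
Proof.
rewrite /turn cos0 sin0 subrr !mul0r subrr mul0r addr0 !mulr1 mul1r add0r.
exact: point3_eta.
Qed.

Lemma twist0 x : twist 0 x = x.
Proof. by rewrite /twist !mul0r turn0. Qed.

Lemma twist_out s x : 3 <= core_dist2 x -> twist s x = x.
Proof. by move=> x3; rewrite /twist cutoff_out // mulr0 turn0. Qed.

(** Cylindrical coordinates; the longitude is given by its cosine and sine, which
    spares the choice of an angle. *)
Definition cylinder (c s r z : R) : R3 := point3 (r * c) (r * s) z.

Section Cylinder.
Variables c s : R.
Hypothesis cs1 : c * c + s * s = 1.

Lemma axis_dist_cylinder r z : 0 <= r -> axis_dist (cylinder c s r z) = r.
Proof.
move=> r0; rewrite /axis_dist !point3E.
have -> : r * c * (r * c) + r * s * (r * s) = r ^+ 2 * (c * c + s * s) by ring.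
by rewrite cs1 mulr1 sqrtr_sqr ger0_norm.
Qed.

Lemma core_dist2_cylinder r z : 0 <= r ->
  core_dist2 (cylinder c s r z) = (r - 2) * (r - 2) + z * z.
Proof. by move=> r0; rewrite /core_dist2 axis_dist_cylinder // point3E. Qed.

Lemma turn_cylinder a r z : 4^-1 <= r -> turn a (cylinder c s r z) =
  cylinder c s (2 + (cos a * (r - 2) - sin a * z)) (sin a * (r - 2) + cos a * z).
Proof.
move=> r4; have r0 : 0 < r by lra.
rewrite /turn axis_dist_cylinder ?(ltW r0) // !point3E ger0_norm ?subr_ge0 //.
have -> : 4^-1 + (r - 4^-1) = r by ring.
by congr point3; field; rewrite gt_eqF.
Qed.

End Cylinder.

(** The solid torus lies at distance at least 2 - sqrt 3 > 1/4 from the axis. *)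
Lemma cylinderP x : core_dist2 x < 3 -> exists c s r z,
  [/\ c * c + s * s = 1, 4^-1 <= r & x = cylinder c s r z].
Proof.
move=> x3; set r := axis_dist x.
have r4 : 4^-1 <= r.
  rewrite leNgt; apply/negP => r4; move: x3; rewrite /core_dist2 -/r.
  by have := sqr_ge0 (x ord0 2%:R); nra.
have r0 : r != 0 by rewrite gt_eqF //; lra.
have r2 : r * r = x ord0 0 * x ord0 0 + x ord0 1 * x ord0 1.
  by rewrite -expr2 sqr_sqrtr // addr_ge0 // -expr2 sqr_ge0.
exists (x ord0 0 / r), (x ord0 1 / r), r, (x ord0 2%:R); split => //.
  transitivity ((x ord0 0 * x ord0 0 + x ord0 1 * x ord0 1) / (r * r)).
    by field.
  by rewrite -r2 divff ?mulf_neq0.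
by rewrite -[LHS]point3_eta /cylinder; congr point3; field.
Qed.

(** A turn preserves the distance to the core circle, hence the damped angle, so
    turning back by the angle computed at the image undoes it. *)
Lemma twistK s : cancel (twist s) (twist (- s)).
Proof.
move=> x; have [x3|x3] := leP 3 (core_dist2 x); first by rewrite !twist_out.
have [c [d [r [z [cd r4 xE]]]]] := cylinderP x3.
have r0 : 0 <= r by lra.
move: x3; rewrite /twist xE core_dist2_cylinder // => x3.
set a := s * _ * _; rewrite turn_cylinder //.
have cs := cos2Dsin2 a.
set r' := 2 + _; set z' := sin a * _ + _.
have E : (r' - 2) * (r' - 2) + z' * z' = (r - 2) * (r - 2) + z * z.
  transitivity ((cos a ^+ 2 + sin a ^+ 2) * ((r - 2) * (r - 2) + z * z)).
    by rewrite /r' /z'; ring.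
  by rewrite cs mul1r.
have r'4 : 4^-1 <= r'.
  rewrite leNgt; apply/negP => r'4.
  have := sqr_ge0 z'; nra.
have r'0 : 0 <= r' by lra.
rewrite core_dist2_cylinder // E !mulNr -/a turn_cylinder // cosN sinN /r' /z'.
congr cylinder.
  transitivity (2 + (cos a ^+ 2 + sin a ^+ 2) * (r - 2)); first by ring.
  by rewrite cs; ring.
transitivity ((cos a ^+ 2 + sin a ^+ 2) * z); first by ring.
by rewrite cs; ring.
Qed.

Lemma core_dist2_large (x : R3) : 4 < `|x| -> 3 <= core_dist2 x.
Proof.
move=> x4; rewrite leNgt; apply/negP => x3.
have [c [s [r [z [cs r4 xE]]]]] := cylinderP x3.
move: x3; rewrite xE core_dist2_cylinder => [|//|]; last by lra.
move=> x3; move: x4; apply/negP; rewrite xE -leNgt.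
have := (sqr_ge0 z, sqr_ge0 (r - 2), sqr_ge0 c, sqr_ge0 s) => -[[[z0 r0] c0] s0].
have r_lt4 : r < 4 by nra.
rewrite [leLHS]/Num.norm /= mx_normrE; apply/bigmax_leP; split => //= -[i j] _.
rewrite (ord1 i) /=; move: j; apply: ord3_ind; rewrite point3E ler_norml.
- have c1 : -1 <= c <= 1 by apply/andP; split; nra.
  by apply/andP; split; nra.
- have s1 : -1 <= s <= 1 by apply/andP; split; nra.
  by apply/andP; split; nra.
- by apply/andP; split; nra.
Qed.

Lemma twist_continuous (T : topologicalType) (f : T -> R) (g : T -> R3) :
  continuous f -> continuous g -> continuous (fun t => twist (f t) (g t)).
Proof.
move=> cf cg.
have cx i : continuous (fun t => g t ord0 i).
  move=> t; apply: (@continuous_comp _ _ _ g (fun v : R3 => v ord0 i)).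
    exact: cg.
  exact: coord_continuous.
rewrite /twist /turn /cutoff /core_dist2 /axis_dist; prove_continuous.
all: apply: fun_continuousV; last by prove_continuous.
all: by move=> u; rewrite gt_eqF // ltr_pwDl // invr_gt0.
Qed.

Lemma twist_isotopy : compactly_supported_isotopy twist.
Proof.
split; first exact: twist0.
  by exists 4 => s x /core_dist2_large; exact: twist_out.
exists (fun s => twist (- s)); split.
- by apply: twist_continuous => u; [exact: cvg_fst | exact: cvg_snd].
- apply: twist_continuous => u; last exact: cvg_snd.
  by apply: continuousN; exact: cvg_fst.
- by move=> s; split; [exact: twistK | rewrite -{2}[s]opprK; exact: twistK].
Qed.

Lemma twist1_cylinder c s u v : c * c + s * s = 1 ->
  -1 <= u <= 1 -> -1 <= v <= 1 ->
  twist 1 (cylinder c s (2 + u) v) = cylinder c s (2 - v) u.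
Proof.
move=> cs /andP[u1 u2] /andP[v1 v2].
rewrite /twist core_dist2_cylinder //; last by lra.
rewrite cutoff_in; last by nra.
rewrite mulr1 mul1r turn_cylinder //; last by lra.
by rewrite cos_pihalf sin_pihalf; congr cylinder; ring.
Qed.

End QuarterTurn.

(** * The half-period shift of the curve *)

Section LissajousKnots.
Variable R : realType.
Variables N q p : nat.

Lemma lissajous_toricE (phi t : R) : lissajous_toric N q p phi t =
  cylinder (cos (N%:R * t)) (sin (N%:R * t)) (2 + sin (q%:R * t))
           (cos (p%:R * (t + phi))).
Proof. by []. Qed.

Lemma lissajous_toric_knot (phi : R) : ~ critical_phase N q p phi ->
  is_knot (lissajous_toric N q p phi).
Proof.
move=> ncrit; split.
- have cid : continuous (fun t : R => t) by move=> t; exact: cvg_id.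
  by rewrite /lissajous_toric; prove_continuous.
- move=> t; rewrite /lissajous_toric.
  have periodn n (u : R) : n%:R * (u + pi *+ 2) = n%:R * u + (pi *+ 2) *+ n.
    by rewrite mulrDr [n%:R * (pi *+ 2)]mulr_natl.
  rewrite [t + _ + phi]addrAC !periodn.
  by rewrite !(periodicn (@sinD2pi _)) !(periodicn (@cosD2pi _)).
- move=> s t; rewrite !in_itv /= => /andP[s0 s2] /andP[t0 t2] st.
  have [lt_st|lt_ts|//] := ltgtP s t; exfalso; apply: ncrit.
    by exists s, t; split.
  by exists t, s; split.
Qed.

Lemma lissajous_toricDpi (phi t : R) : odd N ->
  lissajous_toric N q p phi (t + pi) =
  cylinder (- cos (N%:R * t)) (- sin (N%:R * t))
           (2 + (-1) ^+ odd q * sin (q%:R * t))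
           ((-1) ^+ odd p * cos (p%:R * (t + phi))).
Proof.
move=> oddN; have muln n (u : R) : n%:R * (u + pi) = n%:R * u + pi *+ n.
  by rewrite mulrDr [n%:R * pi]mulr_natl.
rewrite lissajous_toricE [t + _ + phi]addrAC !muln.
rewrite !(alternatingn (@sinDpi _)) !(alternatingn (@cosDpi _)).
rewrite -(signr_odd _ N) -(signr_odd _ q) -(signr_odd _ p).
by rewrite oddN expr1 !mulN1r.
Qed.

Lemma antipode_cylinder (c s r z : R) :
  antipode (cylinder c s r z) = cylinder (- c) (- s) r (- z).
Proof. by rewrite /antipode !point3E /cylinder !mulrN. Qed.

Lemma antipode_lissajous_toric (phi t : R) : odd N -> ~~ odd q -> odd p ->
  antipode (lissajous_toric N q p phi t) = lissajous_toric N q p phi (t + pi).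
Proof.
move=> oddN /negPf evenq oddp.
by rewrite lissajous_toricDpi // evenq oddp mul1r mulN1r -antipode_cylinder.
Qed.

(** After the twist the roles of q and p are exchanged: the distance to the axis is
    2 - cos (p (t + phi)), unchanged by the shift, and the height is sin (q t),
    which changes sign. *)
Lemma antipode_twist_lissajous_toric (phi t : R) : odd N -> odd q -> ~~ odd p ->
  antipode (twist 1 (lissajous_toric N q p phi t)) =
  twist 1 (lissajous_toric N q p phi (t + pi)).
Proof.
move=> oddN oddq /negPf evenp.
have cs : cos (N%:R * t) * cos (N%:R * t) + sin (N%:R * t) * sin (N%:R * t) = 1.
  by rewrite -!expr2 cos2Dsin2.
have sin1 : -1 <= sin (q%:R * t) <= 1 by rewrite sin_geN1 sin_le1.
have cos1 : -1 <= cos (p%:R * (t + phi)) <= 1 by rewrite cos_geN1 cos_le1.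
rewrite lissajous_toricDpi // oddq evenp mul1r mulN1r lissajous_toricE.
rewrite !twist1_cylinder ?mulrNN ?antipode_cylinder //.
by rewrite !lerN2 lerNl andbC; case/andP: sin1 => *; apply/andP; split; lra.
Qed.

End LissajousKnots.

(** * The symmetry of Lissajous toric knots *)

Lemma stationary_isotopy (R : realType) :
  compactly_supported_isotopy (fun (_ : R) (x : 'rV[R]_3) => x).
Proof.
split; [by [] | by exists 0 |].
exists (fun _ x => x); split; last by [].
- by move=> u; exact: cvg_snd.
- by move=> u; exact: cvg_snd.
Qed.

Theorem proposition3 (R : realType) (N q p : nat)
    (hN : (0 < N)%N) (hq : (0 < q)%N) (hp : (0 < p)%N)
    (hNq : coprime N q) (hNp : coprime N p) (hpq : odd p != odd q) :
  [/\ odd N,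
      ~~ odd q -> forall phi : R,
        preserved_with_orientation (@antipode R) (lissajous_toric N q p phi) &
      forall phi : R, ~ critical_phase N q p phi ->
        has_preserved_representative (@antipode R) (lissajous_toric N q p phi)
        /\ positive_strongly_amphicheiral (lissajous_toric N q p phi)].
Proof.
have oddN : odd N.
  have odd_coprime n : coprime N n -> ~~ odd n -> odd N.
    rewrite -dvdn2 => Nn n2; rewrite -coprimen2.
    exact: coprime_dvdr n2 Nn.
  have [oddq|evenq] := boolP (odd q); last exact: odd_coprime hNq evenq.
  by apply: odd_coprime hNp _; move: hpq; rewrite oddq; case: odd.
split=> //.
  move=> evenq phi; exists (fun t => t + pi); first exact: reparam_shift.
  move=> t; apply: antipode_lissajous_toric => //.
  by move: hpq; rewrite (negPf evenq); case: odd.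
move=> phi /lissajous_toric_knot knotK.
have [oddq|evenq] := boolP (odd q).
  apply: (symmetric_after_isotopy knotK (@twist_isotopy R)) => t.
  apply: antipode_twist_lissajous_toric => //.
  by move: hpq; rewrite oddq; case: odd.
apply: (symmetric_after_isotopy knotK (@stationary_isotopy R)) => t.
apply: antipode_lissajous_toric => //.
by move: hpq; rewrite (negPf evenq); case: odd.
Qed.
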